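(* Let $T$ be an ergodic, invertible, measure-preserving map of a standard probability space $(X,\mathcal B,\mu)$, and let $(N_i)$ be an unbounded sequence of positive integers. Then there is a dense $G_\delta$ set $\mathcal O$ in $L^1=L^1(X,\mathcal B,\mu)$ such that for every $f\in\mathcal O$ and for almost every $x\in X$, $\mathbb A_{[N_i]}f(T^nx)$ fluctuates infinitely often around its mean. That is, for a.e. $x$, we have $\mathbb A_{[N_i]}f(T^nx)>\int f\,d\mu$ for infinitely many $i$ and $\mathbb A_{[N_i]}f(T^nx)<\int f\,d\mu$ for infinitely many (different) $i$.
   Context: $L^1(X,\mathcal B,\mu)$ is the space of real-valued integrable functions on $X$ with the $L^1$-norm topology. For a positive integer $N$, $\mathbb A_{[N]}f(T^nx)=\frac1N\sum_{n=1}^{N}f(T^nx)$.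
   Formalization: The probability space is additionally assumed non-atomic; if atoms are allowed, an ergodic invertible T is a finite cyclic system mod null sets, where the claim always fails (e.g. on a one-point space every average equals the mean). *)

(* Defs.v *)
From HB Require Import structures.
From mathcomp Require Import all_boot all_order all_algebra.
From mathcomp Require Import all_classical all_reals all_analysis.
From mathcomp Require Import measurable_realfun borel_hierarchy.

Set Implicit Arguments.
Unset Strict Implicit.
Unset Printing Implicit Defensive.

Import Order.TTheory GRing.Theory Num.Theory.
Import numFieldNormedType.Exports.

Local Open Scope classical_set_scope.
Local Open Scope ring_scope.

(* The library provides the quotient type [LspaceType1 mu] but no topology on
   it; we equip it with the metric [(f, g) |-> 'N[mu]_1[f - g]].  Elements are
   classes modulo equality a.e. and coerce to functions through a chosen
   representative. *)
Section L1_topology.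
Context d (X : measurableType d) (R : realType).
Variable mu : {measure set X -> \bar R}.
Notation L1 := (LspaceType1 mu).

Definition L1_ball (f : L1) (e : R) : set L1 :=
  [set g : L1 | ('N[mu]_1[EFin \o (f \- g)%R] < e%:E)%E].

Let L1_measurable (f : L1) : measurable_fun [set: X] (f : X -> R).
Proof. exact: (@measurable_funPT _ _ _ _ (repr (LebesgueSpace.sort f))). Qed.

Let L1_ball_center (f : L1) (e : R) : 0 < e -> L1_ball f e f.
Proof.
move=> e0; rewrite /L1_ball/=.
rewrite (_ : EFin \o _ = cst 0%E); first by rewrite Lnorm0.
by apply/funext => x /=; rewrite subrr.
Qed.

Let L1_ball_sym (f g : L1) (e : R) : L1_ball f e g -> L1_ball g e f.
Proof.
rewrite /L1_ball/= => fg.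
rewrite (_ : EFin \o _ = \- (EFin \o (f \- g)%R))%E ?oppe_Lnorm//.
by apply/funext => x /=; rewrite -[RHS]EFinN opprB.
Qed.

Let L1_ball_triangle (f g h : L1) (e1 e2 : R) :
  L1_ball f e1 g -> L1_ball g e2 h -> L1_ball f (e1 + e2) h.
Proof.
rewrite /L1_ball/= => fg gh.
rewrite (_ : (f \- h)%R = ((f \- g) \+ (g \- h))%R); last first.
  by apply/funext => x /=; rewrite addrA subrK.
rewrite (le_lt_trans (eminkowski _ _ _ _))//.
- exact: measurable_funB.
- exact: measurable_funB.
- by rewrite EFinD lteD.
Qed.

HB.instance Definition _ := gen_eqMixin L1.
HB.instance Definition _ := gen_choiceMixin L1.
HB.instance Definition _ := hasNbhs.Build L1 (nbhs_ (entourage_ L1_ball)).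
HB.instance Definition _ := @Nbhs_isPseudoMetric.Build R L1
  (entourage_ L1_ball) erefl
  L1_ball L1_ball_center L1_ball_sym L1_ball_triangle erefl.

End L1_topology.

(* Isomorphic modulo null sets to a Polish space carrying a Borel probability
   measure; the isomorphism may be with the Borel sigma-algebra or with its
   completion, so that both Borel and complete (Lebesgue-Rokhlin) standard
   spaces are covered. *)
Definition standard_probability_space d (X : measurableType d) (R : realType)
    (mu : probability X R) : Prop :=
  exists (Y : completePseudoMetricType R) (f : X -> Y) (X0 : set X),
  [/\ hausdorff_space Y /\ @second_countable Y,
      measurable X0 /\ mu X0 = 1%E,
      set_inj X0 f /\ <<s @open Y >> (f @` X0),
      (forall B : set Y, <<s @open Y >> B -> measurable (X0 `&` f @^-1` B)) &
      (forall A : set X, measurable A -> exists B C : set Y,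
         [/\ <<s @open Y >> B, <<s @open Y >> C,
             X0 `&` f @^-1` B `<=` A, X0 `&` A `<=` f @^-1` C &
             mu (X0 `&` f @^-1` (C `\` B)) = 0%E])].

Definition atomless d (X : measurableType d) (R : realType)
    (mu : probability X R) : Prop :=
  forall A : set X, measurable A -> (0 < mu A)%E ->
    exists B : set X, [/\ measurable B, B `<=` A & (0 < mu B < mu A)%E].

Definition measure_preserving d (X : measurableType d) (R : realType)
    (mu : probability X R) (T : X -> X) : Prop :=
  measurable_fun [set: X] T /\
  forall A : set X, measurable A -> mu (T @^-1` A) = mu A.

Definition invertible d (X : measurableType d) (T : X -> X) : Prop :=
  exists S : X -> X, [/\ measurable_fun [set: X] S, cancel T S & cancel S T].

Definition ergodic d (X : measurableType d) (R : realType)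
    (mu : probability X R) (T : X -> X) : Prop :=
  forall A : set X, measurable A -> T @^-1` A = A -> mu A = 0%E \/ mu A = 1%E.

Definition ergodic_average (X : Type) (R : realType) (T : X -> X) (N : nat)
    (f : X -> R) (x : X) : R :=
  N%:R^-1 * \sum_(1 <= n < N.+1) f (iter n T x).

(* Main.v *)
(* By Baire's theorem in L^1 it suffices that the following sets W_j are open
   and dense: f belongs to W_j if for some i >= j the average A_{N_i} f exceeds
   the mean of f (for even j; is below it for odd j) outside a set of measure
   less than 1/(j+1). Markov's inequality gives openness.

   For density, let f have mean c. Outside a set of small measure the sums
   S_n f stay above n (c - delta/2) - K for all n simultaneously, which is the
   maximal ergodic theorem for an ergodic transformation: the set where
   sup_n S_n g is infinite is invariant, and g has nonnegative mean if that set
   has full measure. Now subtract from f a multiple of the indicator of a tiny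
   set A, with integral delta. This lowers the mean by delta, but if A is small
   enough, most points do not visit A before time n = N_i, so that their sums
   are unchanged and exceed n (c - delta). *)

Require Import Defs.
From HB Require Import structures.
From mathcomp Require Import all_boot all_order all_algebra.
From mathcomp Require Import all_classical all_reals all_analysis.
From mathcomp Require Import measurable_realfun borel_hierarchy.
From mathcomp Require Import ring lra.

Set Implicit Arguments.
Unset Strict Implicit.
Unset Printing Implicit Defensive.

Import Order.TTheory GRing.Theory Num.Theory.
Import numFieldNormedType.Exports.

Local Open Scope classical_set_scope.
Local Open Scope ring_scope.

(** * Birkhoff sums along an orbit *)

Section birkhoff_sum.
Context {X : Type} {R : realType} (T : X -> X).
Implicit Types (f g : X -> R) (n : nat) (x : X).

(** The orbit is read from [T x] on, not from [x], in agreement with [ergodic_average]; this is why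
    [f \o T] appears in the recursions below. *)
Definition birkhoff_sum n f x : R := \sum_(1 <= k < n.+1) f (iter k T x).

Lemma ergodic_averageE n f x :
  ergodic_average T n f x = n%:R^-1 * birkhoff_sum n f x.
Proof. by []. Qed.

Lemma birkhoff_sum0 f x : birkhoff_sum 0 f x = 0.
Proof. by rewrite /birkhoff_sum big_geq. Qed.

Lemma birkhoff_sumS n f x :
  birkhoff_sum n.+1 f x = f (T x) + birkhoff_sum n f (T x).
Proof.
rewrite /birkhoff_sum big_nat_recl//=; congr (_ + _).
by apply: eq_bigr => k _; rewrite -iterSr.
Qed.

Lemma birkhoff_sumD n f g x :
  birkhoff_sum n (f \+ g) x = birkhoff_sum n f x + birkhoff_sum n g x.
Proof. by rewrite /birkhoff_sum big_split. Qed.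

Lemma birkhoff_sumZ n f (c : R) x :
  birkhoff_sum n (fun y => c * f y) x = c * birkhoff_sum n f x.
Proof. by rewrite /birkhoff_sum mulr_sumr. Qed.

Lemma birkhoff_sum_cst n (c : R) x : birkhoff_sum n (cst c) x = n%:R * c.
Proof.
by rewrite /birkhoff_sum/= big_const_nat iter_addr_0 subn1/= mulr_natl.
Qed.

End birkhoff_sum.

(** * Invariance of integrals under a measure-preserving map *)

Section measure_preserving.
Context {R : realType} {d} {X : measurableType d} (mu : probability X R).
Context (T : X -> X) (mpT : measure_preserving mu T).
Implicit Types f : X -> R.

(** Change of variables, since the pushforward of [mu] by [T] is [mu]. *)
Lemma mp_ge0_integral (f : X -> \bar R) : measurable_fun setT f ->
  (forall x, 0 <= f x)%E -> (\int[mu]_x f (T x) = \int[mu]_x f x)%E.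
Proof.
case: mpT => mT muT mf f0.
rewrite -[LHS](@ge0_integral_pushforward _ _ _ _ _ _ mT mu setT f)//.
by apply: eq_measure_integral => A mA _; exact: muT.
Qed.

Lemma mp_integrable f : mu.-integrable [set: X] (EFin \o f) ->
  mu.-integrable [set: X] (EFin \o (f \o T)).
Proof.
move=> fL; have mf := measurable_int _ fL.
apply/integrableP; split.
  by case: mpT => mT _; exact: (measurableT_comp mf mT).
have -> : (\int[mu]_x `|(EFin \o (f \o T)) x| =
           \int[mu]_x (abse \o (EFin \o f)) (T x))%E by [].
rewrite mp_ge0_integral; [|exact: measurableT_comp|by move=> x /=].
by case/integrableP : fL.
Qed.

Lemma mp_Rintegral f : mu.-integrable [set: X] (EFin \o f) ->
  \int[mu]_x f (T x) = \int[mu]_x f x.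
Proof.
move=> fL; case: mpT => mT muT.
have := @integral_pushforward _ _ _ _ _ _ mT mu setT _ (measurable_int _ fL)
  (mp_integrable fL) measurableT.
rewrite preimage_setT /Rintegral => <-; congr fine.
by apply: eq_measure_integral => A mA _; exact: muT.
Qed.

Lemma mp_iter n : measure_preserving mu (iter n T).
Proof.
elim: n => [|n [mTn muTn]]; first by split => //=; exact: measurable_id.
case: mpT => mT muT; split=> /=; first exact: measurableT_comp.
move=> A mA; rewrite -[X in mu X]/(iter n T @^-1` (T @^-1` A)) muTn ?muT//.
by rewrite -[X in measurable X]setTI; exact: mT.
Qed.

End measure_preserving.

(** * Real-valued integrable functions and measurable comparison sets *)

Section integrable_fun.
Context {R : realType} {d} {X : measurableType d}.
Context (mu : {measure set X -> \bar R}).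
Implicit Types f g : X -> R.

Lemma integrable_EFin_measurable f :
  mu.-integrable [set: X] (EFin \o f) -> measurable_fun setT f.
Proof. by move=> /measurable_int /measurable_EFinP. Qed.

Lemma integrable_EFinD f g :
  mu.-integrable [set: X] (EFin \o f) -> mu.-integrable [set: X] (EFin \o g) ->
  mu.-integrable [set: X] (EFin \o (f \+ g)).
Proof. by move=> fL gL; exact: (integrableD measurableT fL gL). Qed.

Lemma integrable_EFinB f g :
  mu.-integrable [set: X] (EFin \o f) -> mu.-integrable [set: X] (EFin \o g) ->
  mu.-integrable [set: X] (EFin \o (f \- g)).
Proof. by move=> fL gL; exact: (integrableB measurableT fL gL). Qed.

Lemma integrable_EFinZ (c : R) f :
  mu.-integrable [set: X] (EFin \o f) ->
  mu.-integrable [set: X] (EFin \o (fun x => c * f x)).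
Proof. by move=> fL; exact: (integrableZl measurableT c fL). Qed.

Lemma measurable_set_lt f g : measurable_fun setT f -> measurable_fun setT g ->
  measurable [set x | f x < g x].
Proof.
move=> mf mg; have := measurable_fun_ltr mf mg measurableT (Y := [set true]).
by rewrite setTI; apply.
Qed.

Lemma measurable_set_le f g : measurable_fun setT f -> measurable_fun setT g ->
  measurable [set x | f x <= g x].
Proof.
by move=> mf mg; rewrite -[X in measurable X]setTI; exact: measurable_fun_le.
Qed.

End integrable_fun.

(** * Maximal ergodic theorem *)

Section birkhoff_sum_mp.
Context {R : realType} {d} {X : measurableType d} (mu : probability X R).
Context (T : X -> X) (mpT : measure_preserving mu T).
Implicit Types f g : X -> R.

Lemma measurable_birkhoff_sum n f :
  measurable_fun setT f -> measurable_fun setT (birkhoff_sum T n f).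
Proof.
move=> mf; apply: measurable_sum => k.
by apply: measurableT_comp => //; case: (mp_iter mpT k).
Qed.

Lemma integrable_birkhoff_sum n f : mu.-integrable [set: X] (EFin \o f) ->
  mu.-integrable [set: X] (EFin \o birkhoff_sum T n f).
Proof.
move=> fL; elim: n => [|n IH].
  rewrite (_ : birkhoff_sum T 0 f = cst 0); last first.
    by apply/funext => x; rewrite birkhoff_sum0.
  exact: finite_measure_integrable_cst.
rewrite (_ : birkhoff_sum T n.+1 f = (f \o T) \+ (birkhoff_sum T n f \o T)).
  by apply: integrable_EFinD; exact: mp_integrable.
by apply/funext => x; rewrite birkhoff_sumS.
Qed.

(** Triangle inequality; by invariance each of the [n] terms has the same norm as [f]. *)
Lemma Rintegral_normr_birkhoff_sum n f :
  mu.-integrable [set: X] (EFin \o f) ->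
  \int[mu]_x `|birkhoff_sum T n f x| <= n%:R * \int[mu]_x `|f x|.
Proof.
move=> fL; have nfL := integrable_norm fL.
elim: n => [|n IH].
  under eq_Rintegral do rewrite birkhoff_sum0 normr0.
  by rewrite Rintegral_cst// !mul0r.
have SL := integrable_norm (integrable_birkhoff_sum n fL).
rewrite -natr1 mulrDl mul1r.
apply: (@le_trans _ _ (\int[mu]_x (`|birkhoff_sum T n f (T x)| + `|f (T x)|))).
  apply: le_Rintegral => //.
  - exact/integrable_norm/integrable_birkhoff_sum.
  - by apply: integrable_EFinD; [exact: (mp_integrable mpT SL)
      |exact: (mp_integrable mpT nfL)].
  - by move=> x _; rewrite birkhoff_sumS addrC ler_normD.
rewrite RintegralD//; last 2 first.
- exact: (mp_integrable mpT SL).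
- exact: (mp_integrable mpT nfL).
rewrite (mp_Rintegral mpT SL) (mp_Rintegral mpT nfL).
by rewrite lerD2r.
Qed.

(** This is the maximum of the Birkhoff sums of lengths 0 to [n]. The recursive form yields at once
    the identity behind Garsia's proof of the maximal ergodic theorem. *)
Fixpoint birkhoff_max f n : X -> R :=
  if n is m.+1 then (fun x => f (T x) + birkhoff_max f m (T x))^\+ else cst 0.

Lemma birkhoff_max_ge f n x : birkhoff_sum T n f x <= birkhoff_max f n x.
Proof.
elim: n x => [|n IH] x; first by rewrite birkhoff_sum0.
by rewrite birkhoff_sumS /= /funrpos le_max lerD2l IH.
Qed.

Lemma birkhoff_max_ge0 f n x : 0 <= birkhoff_max f n x.
Proof. by case: n => //= n; rewrite /funrpos le_max lexx orbT. Qed.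

Lemma birkhoff_maxS f n x : birkhoff_max f n x <= birkhoff_max f n.+1 x.
Proof.
elim: n x => [|n IH] x; first exact: (birkhoff_max_ge0 f 1).
by rewrite /= /funrpos ge_max !le_max lexx orbT andbT lerD2l IH.
Qed.

Lemma birkhoff_max_homo f x :
  {homo birkhoff_max f ^~ x : m n / (m <= n)%N >-> m <= n}.
Proof.
by apply: homo_leq => [//|y m n|n]; [exact: le_trans|exact: birkhoff_maxS].
Qed.

Lemma integrable_birkhoff_max f n : mu.-integrable [set: X] (EFin \o f) ->
  mu.-integrable [set: X] (EFin \o birkhoff_max f n).
Proof.
move=> fL; elim: n => [|n IH]; first exact: finite_measure_integrable_cst.
apply: integrable_funrpos => //.
by apply: (@integrable_EFinD _ _ _ _ (f \o T) (birkhoff_max f n \o T));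
  exact: mp_integrable.
Qed.

(* The function [max (- M_n) f] becomes [M_(n+1) - M_n \o T] when composed with
   T, hence has nonnegative integral, and it converges to f wherever M_n tends
   to infinity. *)
Lemma birkhoff_unbounded_Rintegral_ge0 f :
  mu.-integrable [set: X] (EFin \o f) ->
  {ae mu, forall x, forall K : R, exists n, K < birkhoff_sum T n f x} ->
  0 <= \int[mu]_x f x.
Proof.
move=> fL aeS; have mf := integrable_EFin_measurable fL.
pose M := birkhoff_max f; pose phi n x := Num.max (- M n x) (f x).
have ML n : mu.-integrable [set: X] (EFin \o M n).
  exact: integrable_birkhoff_max.
have mphi n : measurable_fun setT (phi n).
  apply: measurable_maxr => //; apply: measurableT_comp => //.
  exact: integrable_EFin_measurable (ML n).
have phile n x : `|phi n x| <= `|f x|.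
  rewrite /phi; have := birkhoff_max_ge0 f n x; rewrite -/(M n x) => M0.
  by case: (leP (- M n x) (f x)) => h //; rewrite !ler0_norm; lra.
have phiL n : mu.-integrable [set: X] (EFin \o phi n).
  apply: (le_integrable measurableT _ _ fL) => //; first exact/measurable_EFinP.
  by move=> x _ /=; rewrite lee_fin.
have phi_int n : (0 <= \int[mu]_x (phi n x)%:E)%E.
  rewrite -(fineK (integrable_fin_num measurableT (phiL n))).
  rewrite lee_fin -[leRHS]/(\int[mu]_x phi n x) -(mp_Rintegral mpT (phiL n)).
  have -> : \int[mu]_x phi n (T x) = \int[mu]_x (M n.+1 x - (M n \o T) x).
    apply: eq_Rintegral => x _; rewrite /phi /M /= /funrpos.
    set a := f _; set b := birkhoff_max _ _ _.
    by case: (leP (- b) a) => h; case: (leP (a + b) 0) => h'; lra.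
  rewrite RintegralB//; last exact: mp_integrable.
  rewrite (mp_Rintegral mpT (ML n)) subr_ge0.
  by apply: le_Rintegral => // x _; exact: birkhoff_maxS.
have phi_cvg : {ae mu, forall x, [set: X] x ->
    (EFin \o phi n) x @[n --> \oo] --> (EFin \o f) x}.
  (* As soon as [M n x] exceeds [- f x], [phi n x] equals [f x]: the sequence is eventually
     constant. *)
  apply: filterS aeS => x Sx _; have [n0 n0P] := Sx (- f x).
  apply: cvg_near_cst; near=> n.
  have n0n : (n0 <= n)%N by near: n; exact: nbhs_infty_ge.
  have Mn : - M n x < f x.
    rewrite ltrNl (lt_le_trans n0P)// (le_trans (birkhoff_max_ge _ _ _))//.
    exact: birkhoff_max_homo.
  by rewrite /= /phi max_r ?ltW.
have phi_dom : {ae mu, forall x n, [set: X] x ->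
    (`|(EFin \o phi n) x| <= (abse \o (EFin \o f)) x)%E}.
  by apply: aeW => x n _ /=; rewrite lee_fin.
have [_ _ h] := dominated_convergence measurableT
  (fun n => (measurable_EFinP _ _).2 (mphi n))
  ((measurable_EFinP _ _).2 mf) phi_cvg (integrable_abse fL) phi_dom.
have : (0 <= limn (fun n => \int[mu]_x (EFin \o phi n) x))%E.
  by apply: lime_ge; [apply/cvg_ex; eexists; exact: h|exact: nearW].
rewrite (cvg_lim _ h)// => /fine_ge0.
by [].
Unshelve. all: by end_near. Qed.

(** Ergodicity leaves only the measures 0 and 1, and measure 1 would make the mean nonnegative. *)
Lemma ergodic_birkhoff_sum_bounded f : ergodic mu T ->
  mu.-integrable [set: X] (EFin \o f) -> \int[mu]_x f x < 0 ->
  mu [set x | forall K : nat, exists n, K%:R < birkhoff_sum T n f x] = 0%E.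
Proof.
move=> ergT fL f0; set E := [set x | _].
have mf := integrable_EFin_measurable fL.
have mE : measurable E.
  have -> : E = \bigcap_K \bigcup_n [set x | K%:R < birkhoff_sum T n f x].
    apply/seteqP; split => x Ex K; first by move=> _; have [n] := Ex K; exists n.
    by have [n _] := Ex K I; exists n.
  apply: bigcapT_measurable => K; apply: bigcup_measurable => n _.
  apply: (@measurable_set_lt _ _ _ (cst K%:R)) => //.
  exact: measurable_birkhoff_sum.
(* Passing from [x] to [T x] changes the sums by the single value [f (T x)], which a larger
   threshold absorbs. *)
have TE : T @^-1` E = E.
  apply/seteqP; split => x Ex K.
    have [n] := Ex (Num.bound (`|K%:R - f (T x)|)).
    have := archi_boundP (normr_ge0 (K%:R - f (T x))).
    move=> h1 h2; exists n.+1; rewrite birkhoff_sumS.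
    by have := ler_norm (K%:R - f (T x)); lra.
  (* The length cannot be 0: the empty sum does not exceed a natural number. *)
  have [[|n]] := Ex (Num.bound (`|K%:R + f (T x)|)).
    by rewrite birkhoff_sum0 ltNge ler0n.
  have := archi_boundP (normr_ge0 (K%:R + f (T x))).
  rewrite birkhoff_sumS => h1 h2; exists n.
  by have := ler_norm (K%:R + f (T x)); lra.
have [//|E1] := ergT _ mE TE.
suff : 0 <= \int[mu]_x f x by rewrite leNgt f0.
apply: birkhoff_unbounded_Rintegral_ge0 => //.
exists (~` E); split; first exact: measurableC.
  by rewrite probability_setC// E1 subee.
apply: subsetC => x Ex K; have [n h] := Ex (Num.bound `|K|).
exists n; rewrite (le_lt_trans _ h)// (le_trans (ler_norm _))//.
by rewrite ltW// archi_boundP.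
Qed.

(** Continuity from above: as [K] grows, these sets decrease to the null set of the previous lemma.
    The point is that one [K] serves all [n]. *)
Lemma ergodic_birkhoff_sum_gt_small f (eps : R) : ergodic mu T ->
  mu.-integrable [set: X] (EFin \o f) -> \int[mu]_x f x < 0 -> 0 < eps ->
  exists K : nat,
    (mu [set x | exists n, K%:R < birkhoff_sum T n f x]%R < eps%:E)%E.
Proof.
move=> ergT fL f0 eps0; have mf := integrable_EFin_measurable fL.
pose F (K : nat) := [set x | exists n, K%:R < birkhoff_sum T n f x].
have mF K : measurable (F K).
  rewrite (_ : F K = \bigcup_n [set x | K%:R < birkhoff_sum T n f x]).
    apply: bigcup_measurable => n _.
    apply: (@measurable_set_lt _ _ _ (cst K%:R)) => //.
    exact: measurable_birkhoff_sum.
  by apply/seteqP; split => x [n]; exists n.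
have : mu (F n) @[n --> \oo] --> mu (\bigcap_n F n).
  apply: nonincreasing_cvg_mu => //.
  - by rewrite (le_lt_trans (probability_le1 _ _)) ?ltry.
  - exact: bigcapT_measurable.
  - move=> m n mn; apply/subsetPset => x [k h]; exists k.
    by rewrite (le_lt_trans _ h)// ler_nat.
rewrite (_ : \bigcap_n F n =
    [set x | forall K : nat, exists n, K%:R < birkhoff_sum T n f x]); last first.
  by apply/seteqP; split => x Fx K; [exact: Fx|move=> _; exact: Fx].
rewrite ergodic_birkhoff_sum_bounded// => FK.
have : \forall n \near \oo, (mu (F n) < eps%:E)%E.
  by apply: (FK [set y | y < eps%:E]%E); apply: open_ereal_lt'; rewrite lte_fin.
by move=> [K _ /(_ K (leqnn K))]; exists K.
Qed.

End birkhoff_sum_mp.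

(** * Sets of small positive measure *)

Section small_sets.
Context {R : realType} {d} {X : measurableType d} (mu : probability X R).

Lemma probability_fineK (A : set X) : measurable A -> mu A = (fine (mu A))%:E.
Proof. by move=> mA; rewrite fineK// fin_num_measure. Qed.

Lemma probability_setU_le (A B : set X) : measurable A -> measurable B ->
  (mu (A `|` B) <= mu A + mu B)%E.
Proof. exact: measureU2. Qed.

(** Iterated halving: when [A] is split into two parts of positive measure, one of them has at most
    half the measure of [A]. *)
Lemma atomless_small_set (eps : R) : atomless mu -> 0 < eps ->
  exists A, [/\ measurable A, (0 < mu A)%E & (mu A < eps%:E)%E].
Proof.
move=> atomless_mu eps0.
have halving n :
    exists A, [/\ measurable A, (0 < mu A)%E & (mu A <= (2^-1 ^+ n)%:E)%E].
  elim: n => [|n [A [mA A0 An]]].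
    by exists setT; rewrite probability_setT expr0.
  have [B [mB BA /andP[B0 BltA]]] := atomless_mu _ mA A0.
  have mAB : measurable (A `\` B) by exact: measurableD.
  have ABE : mu (A `\` B) = (mu A - mu B)%E.
    rewrite -{2}(setIidr BA); apply: measureD => //.
    by rewrite ltey_eq fin_num_measure.
  move: A0 An B0 BltA ABE.
  rewrite (probability_fineK mA) (probability_fineK mB).
  rewrite (probability_fineK mAB) -EFinB !lte_fin !lee_fin.
  set a := fine _; set b := fine (mu B); set c := fine _ => a0 an b0 ba [ABE].
  have hn : 2^-1 ^+ n.+1 = 2^-1 ^+ n / 2 :> R by rewrite exprS mulrC.
  have [bn|bn] := leP b (2^-1 ^+ n.+1).
    exists B; split=> //; rewrite (probability_fineK mB).
      by rewrite lte_fin.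
    by rewrite lee_fin.
  exists (A `\` B); split=> //; rewrite (probability_fineK mAB).
    by rewrite lte_fin -/c ABE subr_gt0.
  by rewrite lee_fin -/c ABE; lra.
have : \forall n \near \oo, 2^-1 ^+ n < eps :> R.
  have h : 2^-1 ^+ n @[n --> \oo] --> (0 : R).
    by apply: cvg_expr; rewrite ger0_norm ?invr_ge0//; lra.
  by apply: (cvgr_lt _ h).
move=> [n _ /(_ n (leqnn n)) /= neps]; have [A [mA A0 An]] := halving n.
by exists A; split=> //; rewrite (le_lt_trans An)// lte_fin.
Qed.

Lemma probability_Rintegral_cst (r : R) : \int[mu]_(_ in setT) r = r.
Proof.
rewrite Rintegral_cst// (_ : fine _ = 1) ?mulr1//.
by have /(congr1 fine) := probability_setT mu.
Qed.

Lemma Rintegral_indic (A : set X) : measurable A ->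
  \int[mu]_x \1_A x = fine (mu A).
Proof. by move=> mA; rewrite /Rintegral integral_indic// setIT. Qed.

End small_sets.

(** * Deviation of an average from the mean: perturbation and stability *)

Section deviation.
Context {R : realType} {d} {X : measurableType d} (mu : probability X R).
Context (T : X -> X) (mpT : measure_preserving mu T).
Implicit Types (f g : X -> R) (s : R).

(** With [s] equal to 1 or -1, positivity expresses an average above or below the mean. *)
Definition deviation s n f x : R :=
  s * (ergodic_average T n f x - \int[mu]_y f y).

Lemma integrable_deviation s n f : mu.-integrable [set: X] (EFin \o f) ->
  mu.-integrable [set: X] (EFin \o deviation s n f).
Proof.
move=> fL; apply: integrable_EFinZ.
apply: (@integrable_EFinB _ _ _ _ _ (cst (\int[mu]_y f y))).
  exact/integrable_EFinZ/integrable_birkhoff_sum.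
exact: finite_measure_integrable_cst.
Qed.

Lemma deviationD s n f g x : mu.-integrable [set: X] (EFin \o f) ->
  mu.-integrable [set: X] (EFin \o g) ->
  deviation s n (f \+ g) x = deviation s n f x + deviation s n g x.
Proof.
move=> fL gL; rewrite /deviation !ergodic_averageE birkhoff_sumD RintegralD//.
by ring.
Qed.

(** The average and the mean contribute one norm of [f] each, whatever [n] is. *)
Lemma Rintegral_normr_deviation s n f : `|s| = 1 -> (0 < n)%N ->
  mu.-integrable [set: X] (EFin \o f) ->
  \int[mu]_x `|deviation s n f x| <= 2 * \int[mu]_x `|f x|.
Proof.
move=> s1 n0 fL.
have SL := integrable_norm (integrable_birkhoff_sum mpT n fL).
have n0' : n%:R != 0 :> R by rewrite pnatr_eq0 -lt0n.
have cL := finite_measure_integrable_cst mu (\int[mu]_y `|f y|) measurableT.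
apply: (@le_trans _ _
  (\int[mu]_x (n%:R^-1 * `|birkhoff_sum T n f x| + \int[mu]_y `|f y|))).
  apply: le_Rintegral => //.
  - exact/integrable_norm/integrable_deviation.
  - apply: (@integrable_EFinD _ _ _ _ _ (cst (\int[mu]_y `|f y|))) => //.
    exact: (@integrable_EFinZ _ _ _ _ _ (fun x => `|birkhoff_sum T n f x|)).
  - move=> x _; rewrite /deviation normrM s1 mul1r ergodic_averageE.
    rewrite (le_trans (ler_normB _ _))// lerD//.
      by rewrite normrM ger0_norm.
    exact: le_normr_Rintegral.
rewrite RintegralD//; last first.
  exact: (@integrable_EFinZ _ _ _ _ _ (fun x => `|birkhoff_sum T n f x|)).
rewrite RintegralZl// probability_Rintegral_cst.
rewrite mulrDl mul1r lerD2r.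
rewrite -[leRHS](mulKf n0') ler_pM2l ?invr_gt0 ?ltr0n//.
exact: Rintegral_normr_birkhoff_sum.
Qed.

(** Union bound over [n] preimages of [A], all of measure [mu A]. The times 1 to [n] are those
    entering the Birkhoff sum. *)
Lemma measure_visits_le (A : set X) n : measurable A ->
  measurable [set x | exists2 k, (k < n)%N & A (iter k.+1 T x)] /\
  (mu [set x | exists2 k, (k < n)%N & A (iter k.+1 T x)] <= n%:R%:E * mu A)%E.
Proof.
move=> mA; elim: n => [|n [mV Vn]].
  rewrite (_ : [set x | _] = set0) ?measure0 ?mul0e//.
  by apply/seteqP; split => x //= -[].
set V := [set x | _] in mV Vn.
rewrite (_ : [set x | _] = V `|` iter n.+1 T @^-1` A); last first.
  apply/seteqP; split => x /=.
    move=> [k]; rewrite ltnS leq_eqVlt => /predU1P[->|kn] Ak; first by right.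
    by left; exists k.
  by move=> [[k kn Ak]|Ax]; [exists k => //; exact: ltnW|exists n].
have [mT muT] := mp_iter mpT n.+1.
have mTA : measurable (iter n.+1 T @^-1` A).
  by rewrite -[X in measurable X]setTI; exact: mT.
split; first exact: measurableU.
rewrite (le_trans (probability_setU_le mu mV mTA))//.
rewrite -natr1 EFinD ge0_muleDl ?lee_fin// mul1e leeD//.
by rewrite muT.
Qed.

(* g = - s (delta / mu A) 1_A shifts the mean by [- s delta], but its Birkhoff
   sum of length n vanishes at most points when [n mu(A)] is small. *)
Lemma deviation_perturb s f (delta eps : R) :
  atomless mu -> ergodic mu T -> mu.-integrable [set: X] (EFin \o f) ->
  s * s = 1 -> 0 < delta -> 0 < eps ->
  exists n0, forall n, (n0 <= n)%N -> exists g : X -> R,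
    [/\ mu.-integrable [set: X] (EFin \o g), \int[mu]_x `|g x| = delta &
        (mu [set x | deviation s n (f \+ g) x <= 0]%R < eps%:E)%E].
Proof.
move=> atomless_mu ergT fL ss delta0 eps0.
pose c := \int[mu]_x f x.
(* The mean of [u] is [- delta / 2]. An upper bound [K] on its sums is a lower bound
   [n (s c - delta / 2) - K] on [s] times the sums of [f]. *)
pose u := cst (s * c - delta / 2) \+ (fun x => - s * f x).
have sfL := integrable_EFinZ (- s) fL.
have cstL (r : R) : mu.-integrable [set: X] (EFin \o cst r).
  exact: finite_measure_integrable_cst.
have uL : mu.-integrable [set: X] (EFin \o u).
  exact: integrable_EFinD.
have u0 : \int[mu]_x u x < 0.
  rewrite RintegralD//.
  rewrite probability_Rintegral_cst RintegralZl// -/c /=; lra.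
have e20 : 0 < eps / 2 by lra.
have [K Keps] := ergodic_birkhoff_sum_gt_small mpT ergT uL u0 e20.
(* From here on [n * (delta / 2)] outweighs the loss [K]. *)
exists (Num.bound (K%:R * 2 / delta)) => n n0n.
have Kn : K%:R < n%:R * (delta / 2).
  rewrite mulrA ltr_pdivlMr// -ltr_pdivrMr//.
  apply: (lt_le_trans (archi_boundP _)); last by rewrite ler_nat.
  by rewrite !mulr_ge0// invr_ge0 ltW.
have n0 : 0 < n%:R :> R.
  have : 0 < n%:R * (delta / 2) by rewrite (le_lt_trans _ Kn).
  by rewrite pmulr_lgt0//; lra.
(* [A] depends on [n]: with measure below [eps / 2 / n], its visits up to time [n] cost at most
   [eps / 2]. *)
have [A [mA A0 An]] := atomless_small_set atomless_mu (divr_gt0 e20 n0).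
pose a := fine (mu A).
have muA : mu A = a%:E by exact: probability_fineK.
rewrite muA !lte_fin in A0 An.
have s1 : `|s| = 1.
  by apply/eqP; rewrite -(@eqrXn2 _ 2)// expr1n real_normK ?num_real// expr2 ss.
have AL : mu.-integrable [set: X] (EFin \o (\1_A : X -> R)).
  by apply: integrable_indic; rewrite ?setTI.
pose g x := - s * (delta / a) * \1_A x.
have gL : mu.-integrable [set: X] (EFin \o g) by exact: integrable_EFinZ.
have ag : a != 0 by rewrite gt_eqF.
have intg : \int[mu]_x g x = - s * delta.
  by rewrite RintegralZl// Rintegral_indic// -/a -mulrA divfK.
exists g; split=> //.
  transitivity (\int[mu]_x (delta / a * \1_A x)).
    apply: eq_Rintegral => x _; rewrite /g !normrM normrN s1 mul1r.
    by rewrite normfV (gtr0_norm delta0) (gtr0_norm A0) ger0_norm.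
  by rewrite RintegralZl// Rintegral_indic// -/a divfK.
have [mV Vn] := measure_visits_le n mA.
set V := [set x | _] in mV Vn; set B := [set x | _] in Keps.
have mB : measurable B.
  rewrite (_ : B = \bigcup_n [set x | K%:R < birkhoff_sum T n u x]).
    apply: bigcup_measurable => m _.
    apply: (@measurable_set_lt _ _ _ (cst K%:R)) => //.
    exact: (measurable_birkhoff_sum mpT m (integrable_EFin_measurable uL)).
  by apply/seteqP; split => x [m]; exists m.
apply: (@le_lt_trans _ _ (mu (B `|` V))).
  apply: le_measure; rewrite ?inE.
  - apply: (@measurable_set_le _ _ _ _ (cst 0)) => //.
    apply: (@integrable_EFin_measurable _ _ _ mu).
    exact/integrable_deviation/integrable_EFinD.
  - exact: measurableU.
  (* Off [B] the sums of [u] are at most [K]; off [V] the orbit misses [A] and the sum of [g]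
     vanishes. Then [n] times the deviation is at least [n * (delta / 2) - K]. *)
  move=> x /=; apply: contraPP => /not_orP[nB nV] /=.
  apply/negP; rewrite -ltNge deviationD//.
  have Sg : birkhoff_sum T n g x = 0.
    rewrite /birkhoff_sum big_nat big1// => -[//|k] /andP[_ kn].
    rewrite /g indicE memNset ?mulr0// => Ak; apply: nV.
    by exists k.
  have Su : birkhoff_sum T n u x <= K%:R.
    by rewrite leNgt; apply/negP => h; apply: nB; exists n.
  move: Su; rewrite birkhoff_sumD birkhoff_sum_cst birkhoff_sumZ.
  rewrite /deviation !ergodic_averageE Sg intg -/c mulr0.
  set S := birkhoff_sum _ _ _ _ => Su.
  have -> : s * (n%:R^-1 * S - c) + s * (0 - - s * delta) =
      n%:R^-1 * (s * S - n%:R * (s * c) + n%:R * delta) :> R.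
    have -> : s * (0 - - s * delta) = s * s * delta by ring.
    by rewrite ss; field; rewrite gt_eqF.
  rewrite mulr_gt0 ?invr_gt0//; lra.
rewrite (le_lt_trans (probability_setU_le mu mB mV))//.
rewrite [eps]splitr EFinD lte_leD//.
  by rewrite ge0_fin_numE// (le_lt_trans Vn)// muA -EFinM ltry.
by rewrite (le_trans Vn)// muA -EFinM lee_fin mulrC -ler_pdivlMr// ltW.
Qed.

(* Markov: psi can be nonpositive where phi is not small only if phi and psi
   are far apart. *)
Lemma measure_le0_open (phi : X -> R) (eps : R) :
  mu.-integrable [set: X] (EFin \o phi) ->
  (mu [set x | phi x <= 0]%R < eps%:E)%E ->
  exists2 r : R, 0 < r & forall psi : X -> R,
    mu.-integrable [set: X] (EFin \o psi) ->
    \int[mu]_x `|phi x - psi x| < r ->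
    (mu [set x | psi x <= 0]%R < eps%:E)%E.
Proof.
move=> phiL phi_eps; have mphi := integrable_EFin_measurable phiL.
(* These sets decrease to [phi <= 0], so some [F m] still has measure below [eps], which leaves a
   margin [b] in the values of [phi]. *)
pose F (m : nat) := [set x | phi x < m.+1%:R^-1].
have mF m : measurable (F m) by exact: (@measurable_set_lt _ _ _ _ (cst _)).
have : mu (F m) @[m --> \oo] --> mu (\bigcap_m F m).
  apply: nonincreasing_cvg_mu => //.
  - by rewrite (le_lt_trans (probability_le1 _ _)) ?ltry.
  - exact: bigcapT_measurable.
  - move=> m n mn; apply/subsetPset => x /lt_le_trans; apply.
    by rewrite lef_pV2 ?posrE// ler_nat.
rewrite (_ : \bigcap_m F m = [set x | phi x <= 0]); last first.
  apply/seteqP; split => x /= h; last first.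
    by move=> m _; rewrite /F/= (le_lt_trans h).
  rewrite leNgt; apply/negP => phi0.
  have := h (Num.bound (phi x)^-1) I; rewrite /F/= ltNge => /negP; apply.
  rewrite invf_ple ?posrE// (le_trans (ltW (archi_boundP _)))//.
    by rewrite invr_ge0 ltW.
  by rewrite ler_nat.
move=> Fcvg.
have [m Fm] : exists m, (mu (F m) < eps%:E)%E.
  have : \forall m \near \oo, (mu (F m) < eps%:E)%E.
    by apply: (Fcvg [set y | y < eps%:E]%E); apply: open_ereal_lt'.
  by move=> [m _ /(_ m (leqnn m))]; exists m.
have muF := probability_fineK mu (mF m).
pose b : R := m.+1%:R^-1; have b0 : 0 < b by rewrite invr_gt0.
move: Fm; rewrite muF lte_fin => Fm.
(* Chosen so that Markov's inequality at level [b] gives the set [D] measure less than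
   [eps - mu (F m)]. *)
exists (b * (eps - fine (mu (F m)))); first by rewrite mulr_gt0// subr_gt0.
move=> psi psiL h; have mpsi := integrable_EFin_measurable psiL.
have dL := integrable_EFinB phiL psiL.
pose D := [set x | (b%:E <= `|(phi x - psi x)%:E|)%E].
have md := measurable_int _ dL.
have mD : measurable D.
  apply: (@measurable_set_le _ _ _ (cst b) (fun x => `|phi x - psi x|)) => //.
  by apply: measurableT_comp => //; exact: measurable_funB.
have bD := le_integral_abse mu measurableT md b0.
rewrite setTI -/D in bD.
have {bD}bD : fine (mu D) < eps - fine (mu (F m)).
  rewrite -(ltr_pM2l b0) (le_lt_trans _ h)// -lee_fin EFinM.
  rewrite fineK ?fin_num_measure// (le_trans bD)// /Rintegral fineK//.
  exact: (integrable_fin_num measurableT (integrable_norm dL)).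
apply: (@le_lt_trans _ _ (mu (F m `|` D))).
  apply: le_measure; rewrite ?inE.
  - exact: (@measurable_set_le _ _ _ _ (cst 0)).
  - exact: measurableU.
  move=> x /= psi0; have [phib|phib] := ltP (phi x) b; [by left|right].
  rewrite /D/= lee_fin (le_trans _ (ler_norm _))//.
  by rewrite (le_trans phib)// lerBrDr gerDl.
rewrite (le_lt_trans (probability_setU_le mu (mF m) mD))// muF.
rewrite (probability_fineK mu mD) -EFinD lte_fin; lra.
Qed.

Lemma deviation_le0_open s n f (eps : R) : `|s| = 1 -> (0 < n)%N ->
  mu.-integrable [set: X] (EFin \o f) ->
  (mu [set x | deviation s n f x <= 0]%R < eps%:E)%E ->
  exists2 r : R, 0 < r & forall g : X -> R,
    mu.-integrable [set: X] (EFin \o g) ->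
    \int[mu]_x `|f x - g x| < r ->
    (mu [set x | deviation s n g x <= 0]%R < eps%:E)%E.
Proof.
move=> s1 n0 fL /(measure_le0_open (integrable_deviation s n fL))[r r0 rP].
(* Halving offsets the factor 2 of [Rintegral_normr_deviation]. *)
exists (r / 2) => [|g gL fg]; first by rewrite divr_gt0.
have fgL := integrable_EFinB fL gL.
apply: rP; first exact: integrable_deviation.
rewrite (_ : (fun x => _) = (fun x => `|deviation s n (f \- g) x|)); last first.
  apply/funext => x; have fE : f = (f \- g) \+ g by apply/funext => y /=; ring.
  by rewrite {1}fE deviationD// addrK.
by rewrite (le_lt_trans (Rintegral_normr_deviation s1 n0 fgL))//; lra.
Qed.

End deviation.

(** * Baire's theorem in a pseudometric space *)

Section baire.
Context {R : realType} {M : pseudoMetricType R}.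

(* All that the proof of Baire's theorem uses of completeness. *)
Definition fast_complete := forall (u : nat -> M) (r : nat -> R),
  (forall n, 0 < r n) -> (forall n, r n.+1 <= r n / 2) ->
  (forall n, ball (u n) (r n / 4) (u n.+1)) ->
  exists l, forall n, ball (u n) (r n) l.

Lemma fast_complete_Baire (V : nat -> set M) : fast_complete ->
  (forall j, open (V j)) -> (forall j, dense (V j)) ->
  dense (\bigcap_j V j).
Proof.
move=> complM oV dV D [f0 Df0] oD.
(* Positivity of the radius is a premise inside the existential, so that [choice] gives a total
   function to iterate. *)
have step (a : nat * (M * R)) : exists b : M * R, 0 < a.2.2 ->
    [/\ 0 < b.2, b.2 <= a.2.2 / 2, ball a.2.1 (a.2.2 / 4) b.1 &
        ball b.1 b.2 `<=` V a.1].
  case: a => j [f r] /=; have [r0|r0] := ltP 0 r; last first.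
    by exists (f, r) => /=; rewrite ltNge r0.
  (* Moves by a quarter of the radius, with radii at least halving, add up to at most [r / 2], so a
     limit stays in the open ball. *)
  have r4 : 0 < r / 4 by rewrite divr_gt0.
  have [g [/interior_subset fg Vg]] : ((ball f (r / 4))° `&` V j) !=set0.
    apply: dV; last exact: open_interior.
    by exists f; exact: nbhsx_ballx.
  have /nbhs_ballP[e /= e0 eV] : nbhs g (V j) by exact: open_nbhs_nbhs.
  exists (g, Num.min (r / 2) e) => _ /=; split=> //.
  - by rewrite lt_min divr_gt0.
  - by rewrite ge_min lexx.
  - by apply: subset_trans eV; apply: le_ball; rewrite ge_min lexx orbT.
have [next nextP] := choice step.
have /nbhs_ballP[r0 /= r00 r0D] : nbhs f0 D by exact: open_nbhs_nbhs.
(* Ball 0 lies in [D] and ball [m.+1] lies in [V m]. *)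
pose fix p n : M * R := if n is m.+1 then next (m, p m) else (f0, r0).
have p0 n : 0 < (p n).2.
  by elim: n => [//|n IH]; have [] := nextP (n, p n) IH.
have pS n := nextP (n, p n) (p0 n).
have [l lP] := complM (fst \o p) (snd \o p) p0
  (fun n => let: And4 _ h _ _ := pS n in h)
  (fun n => let: And4 _ _ h _ := pS n in h).
exists l; split; first exact/r0D/(lP 0%N).
by move=> j _; have [_ _ _] := pS j; apply; exact: (lP j.+1).
Qed.

End baire.

(** * Completeness of L^1 *)

Section L1_space.
Context {R : realType} {d} {X : measurableType d}.
Context (mu : {measure set X -> \bar R}).
Implicit Types f g : LspaceType1 mu.

Lemma measurable_L1 f : measurable_fun setT (f : X -> R).
Proof. exact: (@measurable_funPT _ _ _ _ (repr (LebesgueSpace.sort f))). Qed.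

Lemma integrable_L1 f : mu.-integrable [set: X] (EFin \o f).
Proof.
apply/integrableP; split; first exact/measurable_EFinP/measurable_L1.
by have := @Lebesgue_finite _ _ _ _ _ _ f; rewrite /finite_norm Lnorm1.
Qed.

Lemma L1_ballE f g (e : R) :
  ball f e g = (\int[mu]_x `|(f x - g x)%:E| < e%:E)%E :> Prop.
Proof. by rewrite /ball/= /L1_ball /= Lnorm1. Qed.

(** The class of [h] coerces to a chosen representative, whence equality only almost everywhere. *)
Lemma L1_ae_repr (h : X -> R) : mu.-integrable [set: X] (EFin \o h) ->
  exists f, {ae mu, forall x, f x = h x}.
Proof.
move=> hL.
have mh : measurable_fun setT h by move: hL => /measurable_int /measurable_EFinP.
pose hm : {mfun X >-> measurableTypeR R} :=
  HB.pack h (isMeasurableFun.Build _ _ _ (measurableTypeR R) h mh).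
pose q : {mfun_ mu, X >-> measurableTypeR R} :=
  (\pi_({mfun_ mu, X >-> measurableTypeR R}) hm)%qT.
have qh : {ae mu, forall x, q x = h x}.
  have /eqmodP/asboolP : (repr q = hm %[mod {mfun_ mu, X >-> measurableTypeR R}])%qT.
    exact: reprK.
  by apply: filterS => x /(_ I).
have mq : measurable_fun setT (q : X -> R).
  exact: (@measurable_funPT _ _ _ _ (repr q)).
have qfin : finite_norm mu 1 (q : X -> R).
  rewrite /finite_norm Lnorm1.
  have [_] := integrableP _ _ _ hL; apply: le_lt_trans.
  rewrite le_eqVlt; apply/orP; left; apply/eqP/ge0_ae_eq_integral => //.
  - by apply: measurableT_comp => //; exact/measurable_EFinP.
  - by apply: measurableT_comp => //; exact/measurable_EFinP.
  - by apply: filterS qh => x + _; rewrite /= => ->.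
pose f : LspaceType1 mu :=
  HB.pack q (isFinLebesgue.Build _ _ _ _ _ (lexx 1%E) q qfin).
by exists f.
Qed.

(** Riesz-Fischer argument: the increments are summable in norm, so the sequence converges almost
    everywhere, and Fatou's lemma bounds the distance to the limit. *)
Lemma L1_fast_complete : @fast_complete R (LspaceType1 mu).
Proof.
move=> u r r0 rS ur.
pose I (f g : X -> R) := (\int[mu]_x `|(f x - g x)%:E|)%E.
have mI (f g : X -> R) : measurable_fun setT f -> measurable_fun setT g ->
    measurable_fun setT (fun x => `|(f x - g x)%:E|%E).
  move=> mf mg; apply: measurableT_comp => //; apply/measurable_EFinP.
  exact: measurable_funB.
have mu_ n := measurable_L1 (u n).
(* The bound [r n / 4] is relaxed to a difference so that distances telescope. *)
have uS n : (I (u n) (u n.+1) <= (r n / 2 - r n.+1 / 2)%:E)%E.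
  have := ur n; rewrite L1_ballE => /ltW /le_trans; apply.
  by rewrite lee_fin; have := rS n; lra.
have uD n m : (I (u n) (u (n + m)%N) <= (r n / 2 - r (n + m)%N / 2)%:E)%E.
  elim: m => [|m IH].
    rewrite addn0 subrr /I (eq_integral (cst 0%E)) ?integral0// => x _.
    by rewrite subrr /= normr0.
  have -> : r n / 2 - r (n + m.+1)%N / 2 = (r n / 2 - r (n + m)%N / 2) +
      (r (n + m)%N / 2 - r (n + m.+1)%N / 2) by ring.
  rewrite EFinD; apply: le_trans (leeD IH _); last by rewrite addnS; exact: uS.
  rewrite -ge0_integralD//; try exact: mI.
  apply: ge0_le_integral => //; first exact: mI.
    by apply: emeasurable_funD; exact: mI.
  move=> x _; rewrite /= lee_fin.
  have -> : u n x - u (n + m.+1)%N x =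
    (u n x - u (n + m)%N x) + (u (n + m)%N x - u (n + m.+1)%N x) by ring.
  by rewrite addnS; exact: ler_normD.
pose h n x := `|u n.+1 x - u n x|.
have mh n : measurable_fun setT (h n).
  by apply: measurableT_comp => //; exact: measurable_funB.
have h_sum : (\int[mu]_x (\sum_(0 <= n <oo) (h n x)%:E) < +oo)%E.
  rewrite integral_nneseries//; last 2 first.
  - by move=> n; exact/measurable_EFinP.
  - by move=> n x _; rewrite lee_fin /h.
  apply: (@le_lt_trans _ _ (r 0%N / 2)%:E); last exact: ltry.
  apply: lime_le.
    apply: is_cvg_nneseries => n _ _; apply: integral_ge0 => x _.
    by rewrite lee_fin /h.
  apply: nearW => n.
  apply: (@le_trans _ _ (r 0%N / 2 - r n / 2)%:E); last first.
    by rewrite lee_fin gerBl divr_ge0// ltW.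
  elim: n => [|n IH]; first by rewrite big_geq// subrr.
  rewrite big_nat_recr//=.
  have -> : r 0%N / 2 - r n.+1 / 2 = (r 0%N / 2 - r n / 2) +
      (r n / 2 - r n.+1 / 2) by ring.
  rewrite EFinD leeD//; apply: le_trans (uS n).
  rewrite le_eqVlt; apply/orP; left; apply/eqP/eq_integral => x _.
  by rewrite /h distrC.
(* The upper limit is measurable without any convergence; [fine] replaces infinite values by 0,
   which only concerns a null set. *)
pose l x := fine (limn_esup (fun n => (u n x)%:E)).
have ml : measurable_fun setT l.
  apply: measurableT_comp; first exact: fine_measurable.
  by apply: measurable_fun_limn_esup => n; exact/measurable_EFinP.
have u_cvg : {ae mu, forall x, u n x @[n --> \oo] --> l x}.
  have sumL : mu.-integrable [set: X] (fun x => \sum_(0 <= n <oo) (h n x)%:E)%E.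
    apply/integrableP; split.
      apply: ge0_emeasurable_sum => n; first by move=> x _ _; rewrite lee_fin /h.
      by move=> _; exact/measurable_EFinP.
    apply: le_lt_trans h_sum; rewrite le_eqVlt; apply/orP; left; apply/eqP.
    apply: eq_integral => x _; rewrite gee0_abs//.
    by apply: nneseries_ge0 => n _ _; rewrite lee_fin /h.
  have := integrable_ae measurableT sumL; apply: filterS => x /(_ Logic.I) hx.
  have : cvgn (series (h ^~ x)).
    apply: nnseries_is_cvg => [n|]; first by rewrite /h.
    rewrite -ge0_fin_numE//.
    by apply: nneseries_ge0 => n _ _; rewrite lee_fin /h.
  move=> /(@normed_cvg _ R (telescope (u ^~ x))) hcvg.
  have : cvgn (u ^~ x).
    rewrite (_ : u ^~ x = cst (u 0%N x) \+ series (telescope (u ^~ x))).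
      by apply: is_cvgD => //; exact: is_cvg_cst.
    by apply/funext => n; rewrite {1}(eq_sum_telescope (u ^~ x)).
  move=> /cvg_ex[v uv]; suff -> : l x = v by [].
  have uv' : (EFin \o (u ^~ x)) n @[n --> \oo] --> v%:E.
    by apply: cvg_EFin => //; exact: nearW.
  rewrite /l is_cvg_limn_esupE; last by apply/cvg_ex; exists v%:E.
  by rewrite (cvg_lim _ uv').
have lu n : (I (u n) l <= (r n / 2)%:E)%E.
  pose F (m : nat) x := `|(u n x - u (n + m)%N x)%:E|%E.
  have mF m : measurable_fun setT (F m) by exact: mI.
  have fatouF := fatou mu measurableT mF (fun _ _ _ => abse_ge0 _).
  apply: (@le_trans _ _ (\int[mu]_x limn_einf (F ^~ x))%E); last first.
    apply: le_trans fatouF _.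
    rewrite limn_einf_lim; apply: lime_le; first exact: is_cvg_einfs.
    apply: nearW => m; apply: (@le_trans _ _ (I (u n) (u (n + m)%N))).
      by apply: ereal_inf_lbound; exists m => //=.
    by rewrite (le_trans (uD n m))// lee_fin gerBl divr_ge0// ltW.
  rewrite le_eqVlt; apply/orP; left; apply/eqP/ge0_ae_eq_integral => //.
  - exact: mI.
  (* Measurability of the lower limit is reduced to that of an upper limit. *)
  - rewrite (_ : (fun x => _) = fun x => - limn_esup (fun m => - F m x))%E.
      apply: measurableT_comp => //; apply: measurable_fun_limn_esup => m.
      exact: measurableT_comp.
    apply/funext => x; rewrite -limn_einfN; congr limn_einf.
    by apply/funext => m; exact: esym (oppeK _).
  - move=> x _; rewrite limn_einf_lim; apply: lime_ge; first exact: is_cvg_einfs.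
    by apply: nearW => m; apply: le_ereal_inf_tmp => _ [k _ <-]; exact: abse_ge0.
  apply: filterS u_cvg => x ux _.
  suff uN : F m x @[m --> \oo] --> `|(u n x - l x)%:E|%E.
    by have [-> _] := cvg_limn_einf_sup uN.
  apply: cvg_EFin; first exact: nearW.
  apply: cvg_norm; apply: cvgB; first exact: cvg_cst.
  rewrite (_ : (fun m => _) = fun m => u (m + n)%N x).
    by rewrite (cvg_shiftn n (u ^~ x)).
  by apply/funext => m; rewrite addnC.
have lL : mu.-integrable [set: X] (EFin \o l).
  have -> : l = u 0%N \- (u 0%N \- l) by apply/funext => x /=; ring.
  apply: integrable_EFinB; first exact: integrable_L1.
  apply/integrableP; split; first exact/measurable_EFinP/measurable_funB.
  by rewrite (le_lt_trans (lu 0%N))// ltry.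
have [f fl] := L1_ae_repr lL; exists f => n; rewrite L1_ballE.
apply: (@le_lt_trans _ _ (r n / 2)%:E); last first.
  by rewrite lte_fin; have := r0 n; lra.
apply: le_trans (lu n).
rewrite le_eqVlt; apply/orP; left; apply/eqP/ge0_ae_eq_integral => //.
- exact/mI/measurable_L1.
- exact: mI.
- by apply: filterS fl => x + _; rewrite /= => ->.
Qed.

End L1_space.

Lemma infinite_set_nat (A : set nat) :
  (forall k, exists2 i, (k <= i)%N & A i) -> infinite_set A.
Proof.
move=> Ainf /finite_seqP[s As].
have [i] := Ainf (\max_(k <- s) k).+1; rewrite As /= => si is'.
by move: si; rewrite ltnNge leq_bigmax_seq.
Qed.

(** * The residual set of fluctuating functions *)

Section fluctuation.
Context {R : realType} {d} {X : measurableType d} (mu : probability X R).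
Context (T : X -> X) (N : nat -> nat).
Context (mpT : measure_preserving mu T).

(* The sign alternates with j, so that one sequence of open sets handles both
   directions of the fluctuation. *)
Definition fluctuating (j : nat) : set (LspaceType1 mu) :=
  [set f | exists2 i, (j <= i)%N &
    (mu [set x | deviation mu T ((-1) ^+ j) (N i) f x <= 0]%R
      < (j.+1%:R^-1)%:E)%E].

Context (N0 : forall i, (0 < N i)%N).

Lemma L1_ball_Rintegral (f g : LspaceType1 mu) (e : R) :
  ball f e g <-> \int[mu]_x `|f x - g x| < e.
Proof.
have fgL := integrable_EFinB (integrable_L1 f) (integrable_L1 g).
rewrite L1_ballE /Rintegral -lte_fin fineK//.
exact: (integrable_fin_num measurableT (integrable_norm fgL)).
Qed.

Lemma open_fluctuating j : open (fluctuating j).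
Proof.
rewrite openE => f [i ji fi]; apply/nbhs_ballP.
have s1 : `|(-1) ^+ j| = 1 :> R by rewrite normr_sign.
have [r r0 rP] := deviation_le0_open mpT s1 (N0 i) (integrable_L1 f) fi.
exists r => //= g /L1_ball_Rintegral fg.
by exists i => //; exact: rP (integrable_L1 g) fg.
Qed.

Context (atomless_mu : atomless mu).
Context (ergT : ergodic mu T).
Context (N_unbounded : forall M, exists i, (M < N i)%N).

(** A value exceeding the sum of the first [j] values cannot be one of them, which forces the index
    to be at least [j]. *)
Lemma unbounded_large_index j n : exists2 i, (j <= i)%N & (n <= N i)%N.
Proof.
have [i] := N_unbounded (n + \sum_(k < j) N k).
have [ji h|ij] := leqP j i.
  by exists i => //; rewrite (leq_trans _ (ltnW h))// leq_addr.
by rewrite (bigD1 (Ordinal ij))//= ltnNge addnCA leq_addr.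
Qed.

Lemma dense_fluctuating j : dense (fluctuating j).
Proof.
move=> D [f Df] oD.
have /nbhs_ballP[e /= e0 eD] : nbhs f D by exact: open_nbhs_nbhs.
have fL := integrable_L1 f.
have ss : (-1) ^+ j * (-1) ^+ j = 1 :> R by rewrite -expr2 sqrr_sign.
have s1 : `|(-1) ^+ j| = 1 :> R by rewrite normr_sign.
have e20 : 0 < e / 2 by rewrite divr_gt0.
have j0 : 0 < j.+1%:R^-1 :> R by rewrite invr_gt0.
have [n0 n0P] := deviation_perturb mpT atomless_mu ergT fL ss e20 j0.
have [i ji n0i] := unbounded_large_index j n0.
have [g [gL ge fg]] := n0P _ n0i.
have fgL := integrable_EFinD fL gL.
have [h hfg] := L1_ae_repr fgL.
(* [h] equals [f \+ g] only almost everywhere; openness, applied at distance 0, carries the estimate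
   over to [h]. *)
have [r r0 rP] := deviation_le0_open mpT s1 (N0 i) fgL fg.
have aeE (k : X -> R) : mu.-integrable [set: X] (EFin \o k) ->
    \int[mu]_x `|k x - h x| = \int[mu]_x `|k x - (f \+ g) x|.
  move=> kL; congr fine; apply: ge0_ae_eq_integral => //.
  - have khL := integrable_EFinB kL (integrable_L1 h).
    exact: (measurable_int _ (integrable_norm khL)).
  - exact: (measurable_int _ (integrable_norm (integrable_EFinB kL fgL))).
  - by apply: filterS hfg => x + _; rewrite /= => ->.
exists h; split.
  apply/eD/L1_ball_Rintegral; rewrite aeE//.
  rewrite (_ : (fun x => _) = fun x => `|g x|); first by rewrite ge; lra.
  by apply/funext => x /=; rewrite -normrN; congr `|_|; ring.
exists i => //; apply: rP; first exact: integrable_L1.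
rewrite aeE// (_ : (fun x => _) = cst 0).
  by rewrite probability_Rintegral_cst.
by apply/funext => x; rewrite subrr normr0.
Qed.

(** Failure from index [k] on is contained in the exceptional set of every large index of parity
    [b], hence is null. *)
Lemma fluctuating_ae (f : LspaceType1 mu) (b : bool) :
  (forall j, fluctuating j f) ->
  {ae mu, forall x,
    infinite_set [set i | 0 < deviation mu T ((-1) ^+ b) (N i) f x]}.
Proof.
move=> ff; pose dev i := deviation mu T ((-1) ^+ b) (N i) f.
have mdev i : measurable_fun setT (dev i).
  apply: (@integrable_EFin_measurable _ _ _ mu).
  exact: (integrable_deviation mpT _ _ (integrable_L1 f)).
suff : {ae mu, forall x, forall k, exists2 i, (k <= i)%N & 0 < dev i x}.
  by apply: filterS => x; exact: infinite_set_nat.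
apply: ae_foralln => k.
pose B := \bigcap_(i in [set i | (k <= i)%N]) [set x | dev i x <= 0].
have mB : measurable B.
  apply: bigcap_measurable => [|i _]; first by exists k => /=.
  exact: (@measurable_set_le _ _ _ (dev i) (cst 0)).
exists B; split => //; last first.
  move=> x /= + i /= ki; apply: contra_notP => /negP.
  by rewrite -ltNge => ?; exists i.
apply/eqP; rewrite eq_le measure_ge0 andbT.
apply/lee_addgt0Pr => e e0; rewrite add0e.
(* The index [m.*2 + b] has parity [b], is at least [k], and makes the exceptional measure at most
   [e]. *)
pose m := (k + Num.bound e^-1)%N.
have [i mi iB] := ff (m.*2 + b)%N.
have im : (m <= i)%N by rewrite (leq_trans _ mi)// -addnn -addnA leq_addr.
have sE : (-1) ^+ (m.*2 + b) = (-1) ^+ b :> R.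
  by rewrite -signr_odd oddD odd_double /= oddb.
rewrite sE in iB.
apply: (@le_trans _ _ (mu [set x | dev i x <= 0])).
  apply: le_measure; rewrite ?inE//.
    exact: (@measurable_set_le _ _ _ (dev i) (cst 0)).
  by move=> x; apply; rewrite /= (leq_trans _ im)// leq_addr.
rewrite (le_trans (ltW iB))// lee_fin invf_ple ?posrE//.
have /archi_boundP/ltW/le_trans -> // : 0 <= e^-1 by rewrite invr_ge0 ltW.
rewrite ler_nat.
by rewrite ltnW// ltnS (leq_trans (leq_addl k _))// -/m -addnn -addnA leq_addr.
Qed.

End fluctuation.

Theorem theorem3p9 (R : realType) (d : measure_display) (X : measurableType d)
    (mu : probability X R) (T : X -> X) (N : nat -> nat) :
  standard_probability_space mu ->
  atomless mu ->
  invertible T ->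
  measure_preserving mu T ->
  ergodic mu T ->
  (forall i : nat, (0 < N i)%N) ->
  (forall M : nat, exists i : nat, (M < N i)%N) ->
  exists O : set (LspaceType1 mu),
    [/\ dense O, Gdelta O &
        forall f : LspaceType1 mu, O f ->
          {ae mu, forall x : X,
            infinite_set
              [set i : nat | ergodic_average T (N i) f x > \int[mu]_y f y] /\
            infinite_set
              [set i : nat | ergodic_average T (N i) f x < \int[mu]_y f y]}].

Proof.
move=> _ atomless_mu _ mpT ergT N0 N_unbounded.
exists (\bigcap_j @fluctuating R d X mu T N j); split.
- apply: fast_complete_Baire; first exact: L1_fast_complete.
  + exact: open_fluctuating.
  + exact: dense_fluctuating.
- by exists (@fluctuating R d X mu T N); first exact: open_fluctuating.
- move=> f Of; have ff j : @fluctuating R d X mu T N j f by exact: Of.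
  (* Even indices give averages above the mean, odd ones averages below it. *)
  have := fluctuating_ae mpT false ff; have := fluctuating_ae mpT true ff.
  apply: filterS2 => x neg pos; split.
    move: pos; rewrite (_ : [set i | _] =
        [set i | ergodic_average T (N i) f x > \int[mu]_y f y])//.
    by apply/seteqP; split => i /=; rewrite /deviation expr0 mul1r subr_gt0.
  move: neg; rewrite (_ : [set i | _] =
      [set i | ergodic_average T (N i) f x < \int[mu]_y f y])//.
  by apply/seteqP; split => i /=; rewrite /deviation expr1 mulN1r oppr_gt0 subr_lt0.
Qed.
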